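(* Consider a sequence of two-class classification problems indexed by the sample size $n$ (the dimension $p$, the means $\mu_1,\mu_2\in\mathbb{R}^p$, the covariance matrix $\Sigma$ and the regularization parameter $c$ may all depend on $n$). Let $\mu_d=(\mu_1-\mu_2)/2$, $\mu_a=(\mu_1+\mu_2)/2$, and let $\epsilon>0$ be a constant (not depending on $n$) such that $\max_j|\mu_{dj}|>\epsilon$ and $$c>\epsilon+\frac{1}{\max_j|\mu_{dj}|}.$$ Let $\hat\mu_1,\hat\mu_2,\hat\Sigma$ be estimators of $\mu_1,\mu_2,\Sigma$ based on training data of size $n$, and let $a_n\to0$ be a sequence such that $\|\hat\Sigma-\Sigma\|_\infty=O_p(a_n)$ and $\|\hat\mu_i-\mu_i\|_\infty=O_p(a_n)$ for $i=1,2$. Let $$w_c=\operatorname{argmin}_{\|w\|_1\le c,\ w^T\mu_d=1} w^T\Sigma w,\qquad \hat w_c=\operatorname{argmin}_{\|w\|_1\le c,\ w^T\hat\mu_d=1} w^T\hat\Sigma w,$$ where $\hat\mu_d=(\hat\mu_1-\hat\mu_2)/2$, $\hat\mu_a=(\hat\mu_1+\hat\mu_2)/2$, and consider the oracle rule $\delta_{w_c}(x)=1+1(w_c^T(x-\mu_a)<0)$ and the ROAD rule $\hat\delta(x)=1+1(\hat w_c^T(x-\hat\mu_a)<0)$. Then, as $n\to\infty$, $$W(\hat\delta)-W(\delta_{w_c})=O_p(d_n),\qquad d_n=c^2a_n\bigl(1+c^2\|\Sigma\|_\infty\bigr).$$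
   Context: A new observation $X\in\mathbb{R}^p$ belongs to group 1 or group 2 with probability $\tfrac12$ each, and given group $i$ it is distributed as $N_p(\mu_i,\Sigma)$. A classification rule $\delta$ assigns $x$ to group $\delta(x)\in\{1,2\}$; $1(\cdot)$ denotes the indicator function. $W(\delta)$ denotes the misclassification rate of $\delta$, i.e. the probability (over the new observation $X$ and its group label, with the training data, and hence $\hat\mu_1,\hat\mu_2,\hat\Sigma,\hat w_c$, held fixed) that $\delta(X)$ differs from the true group of $X$. For a vector $v$, $\|v\|_1=\sum_j|v_j|$ and $\|v\|_\infty=\max_j|v_j|$; for a matrix $A$, $\|A\|_\infty=\max_{j,k}|A_{jk}|$ (maximal absolute entry). $\mu_{dj}$ is the $j$-th coordinate of $\mu_d$. The minimizer $\hat w_c$ is taken on the event that its feasible set is nonempty. *)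

(* Defs.v *)
From HB Require Import structures.
From mathcomp Require Import all_boot all_order all_algebra.
From mathcomp Require Import all_classical all_reals all_analysis.
Set Implicit Arguments. Unset Strict Implicit. Unset Printing Implicit Defensive.
Import Order.TTheory GRing.Theory Num.Theory.
Local Open Scope classical_set_scope.
Local Open Scope ring_scope.

Section Defs.
Variable R : realType.

Definition dotv (p : nat) (u v : 'cV[R]_p) : R := \sum_(i < p) u i 0 * v i 0.

Definition quadf (p : nat) (S : 'M[R]_p) (w : 'cV[R]_p) : R :=
  \sum_(i < p) \sum_(j < p) w i 0 * S i j * w j 0.

Definition norm1 (p : nat) (v : 'cV[R]_p) : R := \sum_(i < p) `|v i 0|.

Definition normInfv (p : nat) (v : 'cV[R]_p) : R :=
  \big[Num.max/0]_(i < p) `|v i 0|.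

Definition normInfm (p : nat) (A : 'M[R]_p) : R :=
  \big[Num.max/0]_(i < p) \big[Num.max/0]_(j < p) `|A i j|.

Definition is_covariance (p : nat) (S : 'M[R]_p) : Prop :=
  S^T = S /\ forall w : 'cV[R]_p, 0 <= quadf S w.

Definition road_feasible (p : nat) (c : R) (md w : 'cV[R]_p) : Prop :=
  norm1 w <= c /\ dotv w md = 1.

Definition road_argmin (p : nat) (c : R) (md : 'cV[R]_p) (S : 'M[R]_p)
  (w : 'cV[R]_p) : Prop :=
  road_feasible c md w /\
  forall v, road_feasible c md v -> quadf S w <= quadf S v.

Definition lin_rule (p : nat) (w m : 'cV[R]_p) (x : 'cV[R]_p) : nat :=
  if dotv w (x - m) < 0 then 2%N else 1%N.

Definition gauss_law (m v : R) : set R -> \bar R :=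
  if v == 0 then dirac m else normal_prob m (Num.sqrt v).

(* (Y, X) on the probability space Q is a new observation of the two-class
   model: Y in {1,2} with probability 1/2 each and X | Y = i ~ N_p(mu_i, S),
   multivariate normality being expressed (Cramer-Wold) through the laws of
   all linear functionals w^T X. *)
Definition two_class_normal {d} {T : measurableType d} (p : nat)
  (Q : probability T R) (Y : T -> nat) (X : T -> 'cV[R]_p)
  (mu1 mu2 : 'cV[R]_p) (S : 'M[R]_p) : Prop :=
  (forall i : nat, measurable [set t | Y t = i]) /\
  (forall w : 'cV[R]_p, measurable_fun setT (fun t => dotv w (X t))) /\
  (forall (w : 'cV[R]_p) (B : set R), measurable B ->
    Q ([set t | Y t = 1%N] `&` [set t | B (dotv w (X t))]) =
    ((1 / 2)%:E * gauss_law (dotv w mu1) (quadf S w) B)%E) /\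
  (forall (w : 'cV[R]_p) (B : set R), measurable B ->
    Q ([set t | Y t = 2%N] `&` [set t | B (dotv w (X t))]) =
    ((1 / 2)%:E * gauss_law (dotv w mu2) (quadf S w) B)%E).

Definition halfdiff (p : nat) (u v : 'cV[R]_p) : 'cV[R]_p := 2^-1 *: (u - v).
Definition halfsum (p : nat) (u v : 'cV[R]_p) : 'cV[R]_p := 2^-1 *: (u + v).

Definition misclass {d} {T : measurableType d} (p : nat)
  (Q : probability T R) (Y : T -> nat) (X : T -> 'cV[R]_p)
  (delta : 'cV[R]_p -> nat) : R :=
  fine (Q [set t | delta (X t) <> Y t]).

Definition bigOp {d} {T : nat -> measurableType d}
  (P : forall n, probability (T n) R) (Z : forall n, T n -> R) (r : nat -> R) :
  Prop :=
  forall eta : R, 0 < eta -> exists M : R, 0 < M /\ exists N : nat,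
    forall n : nat, (N <= n)%N -> exists A : set (T n),
      measurable A /\ ((1 - eta)%:E <= P n A)%E /\
      forall om, A om -> `|Z n om| <= M * r n.

End Defs.

(* Main.v *)
(** For mean separation [m > 0] and variance [v] the normal error probability is
    [Phi (- m / sqrt v)], a function of the ratio [u = v / m^2] alone.  As a function
    of [u] it is Lipschitz down to the degenerate value [u = 0], because the normal
    density at [t] is [O(|t|^-3)] and [|t|^-3] integrates to a difference of inverse
    squares.  It thus suffices to compare the ratios of the two rules.  The constraint
    [wh^T mdh = 1] makes the separations of the ROAD rule [1 + O(c a_n)].  For the
    variances, a vector that is feasible for one mean difference is moved to one that
    is feasible for the other, at l1 distance [O(c^3 a_n)], by mixing in a multiple of a
    coordinate vector whose l1 norm stays below [c] by a fixed margin; such a vector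
    exists because [c > eps + 1 / max_j |mu_dj|]. *)
Require Import Defs.
From HB Require Import structures.
From mathcomp Require Import all_boot all_order all_algebra.
From mathcomp Require Import all_classical all_reals all_analysis.
From mathcomp Require Import measurable_realfun ring lra.
Set Implicit Arguments. Unset Strict Implicit. Unset Printing Implicit Defensive.
Import Order.TTheory GRing.Theory Num.Theory.
Import numFieldNormedType.Exports.
Local Open Scope classical_set_scope.
Local Open Scope ring_scope.

(** * Tail of the normal law and the error probability as a function of the variance ratio *)

Section gauss.
Variable R : realType.
Implicit Types (x y m s k u v : R).
Notation mu := (@lebesgue_measure R).

(** Writing [expR (y ^+ 2 / 2)] as the square of [expR (y ^+ 2 / 4)], one factor is at least [- y]
    and the other at least [y ^+ 2 / 4]. *)
Lemma expR_half_sqr_le y : y < 0 -> expR (- (y ^+ 2 / 2)) <= - 4 / y ^+ 3.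
Proof.
move=> y0; have h1 : 1 + y ^+ 2 / 4 <= expR (y ^+ 2 / 4) := expR_ge1Dx _.
have h2 : - y <= 1 + y ^+ 2 / 4 by have := sqr_ge0 (1 + y / 2); nra.
have y3 : 0 < - y ^+ 3 by rewrite oppr_gt0 exprn_odd_lt0.
have e2 : expR (y ^+ 2 / 2) = expR (y ^+ 2 / 4) ^+ 2.
  by rewrite -expRM_natl; congr expR; field.
have h3 : - y ^+ 3 / 4 <= expR (y ^+ 2 / 2).
  rewrite e2; apply: (@le_trans _ _ ((1 + y ^+ 2 / 4) ^+ 2)); last first.
    by rewrite lerXn2r ?nnegrE ?expR_ge0 ?addr_ge0 ?divr_ge0 ?sqr_ge0.
  apply: (@le_trans _ _ ((- y) * (1 + y ^+ 2 / 4))); last first.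
    by rewrite expr2 ler_wpM2r// addr_ge0 ?divr_ge0 ?sqr_ge0.
  by have := sqr_ge0 y; nra.
rewrite expRN invf_ple ?posrE ?expR_gt0//; last first.
  by rewrite mulNr oppr_gt0 pmulr_rlt0// invr_lt0 exprn_odd_lt0.
apply: le_trans h3; rewrite invf_div invrN mulrN mulNr lexx//.
Qed.

Lemma normal_pdf01_le y : y < 0 ->
  normal_pdf 0 1 y <= - (4 * normal_peak 1) * y ^- 3.
Proof.
move=> y0; rewrite normal_pdfE ?oner_eq0// /normal_fun subr0 expr1n.
rewrite (_ : _ * y ^- 3 = normal_peak 1 * (- 4 / y ^+ 3)); last by ring.
rewrite ler_wpM2l ?normal_peak_ge0//.
by have := expR_half_sqr_le y0; rewrite -[in X in X -> _]mulNr.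
Qed.

Lemma continuous_negXV n : {in [set x : R | x < 0], continuous (fun x => x ^- n)}.
Proof.
move=> x; rewrite inE /= => x0; apply: cvgV; last exact: exprn_continuous.
by rewrite expf_neq0// lt_eqF.
Qed.

Lemma integral_negX3 k x y : x < y -> y < 0 ->
  (\int[mu]_(z in `[x, y]) (- (2 * k) * z ^- 3)%:E = (k * (y ^- 2 - x ^- 2))%:E)%E.
Proof.
move=> xy y0.
have D (z : R) : z < 0 -> is_derive z 1 (fun z : R => k * z ^- 2) (- (2 * k) * z ^- 3).
  move=> z0; have zn0 : z ^+ 2 != 0 by rewrite expf_neq0 // lt_eqF.
  apply: is_derive_eq; rewrite /GRing.scale/=.
  by field; rewrite lt_eqF.
have zlt z : z \in `[x, y] -> z < 0.
  by rewrite in_itv/= => /andP[_ zy]; exact: le_lt_trans y0.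
have cF z : z < 0 -> {for z, continuous (fun z : R => k * z ^- 2)}.
  by move=> z0; apply: cvgM; [exact: cvg_cst | apply: continuous_negXV; rewrite inE].
rewrite (@continuous_FTC2 _ _ (fun z => k * z ^- 2)) //.
- by rewrite -EFinB mulrBr.
- apply: continuous_in_subspaceT => z; rewrite inE/= => /zlt z0.
  by apply: cvgM; [exact: cvg_cst | apply: continuous_negXV; rewrite inE].
- split.
  + move=> z; rewrite in_itv/= => /andP[_ zy].
    by have := D z (lt_trans zy y0) => ?; exact: ex_derive.
  + exact/cvg_at_right_filter/cF/(lt_trans xy).
  + exact/cvg_at_left_filter/cF.
- move=> z; rewrite in_itv/= => /andP[_ zy]; rewrite derive1E.
  by have := D z (lt_trans zy y0) => ?; rewrite derive_val.
Qed.

Definition normal_cdf x : R := fine (normal_prob 0 1 `]-oo, x]).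

Lemma normal_cdfE x : (normal_cdf x)%:E = normal_prob 0 1 `]-oo, x].
Proof. by rewrite /normal_cdf fineK// fin_num_measure. Qed.

Lemma normal_cdf_increment x y : x < y -> y < 0 ->
  normal_cdf x <= normal_cdf y <= normal_cdf x + 2 * normal_peak 1 * (y ^- 2 - x ^- 2).
Proof.
move=> xy y0; rewrite -!lee_fin EFinD !normal_cdfE; apply/andP; split.
  apply: le_measure; rewrite ?inE//.
  by move=> z /=; rewrite !in_itv/= => /le_trans; apply; exact: ltW.
rewrite (_ : `]-oo, y]%classic = `]-oo, x] `|` `]x, y]); last first.
  by rewrite -itv_bndbnd_setU// bnd_simp ltW.
rewrite measureU//; last first.
  by rewrite -subset0 => z /=; rewrite !in_itv/= => -[h /andP[]]; rewrite ltNge h.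
(* With [k = 2 * normal_peak 1] the increment of inverse squares is the integral of the cubic bound
   on the density, so only integrands remain to be compared. *)
rewrite leeD2l// -integral_negX3//.
apply: (@le_trans _ _ (normal_prob 0 1 `[x, y])).
  apply: le_measure; rewrite ?inE//; exact: subset_itv_oc_cc.
have mf : measurable_fun `[x, y] (fun z : R => - (2 * (2 * normal_peak 1)) * z ^- 3).
  apply: subspace_continuous_measurable_fun => //.
  apply: continuous_in_subspaceT => z; rewrite inE/= in_itv/= => /andP[_ zy].
  apply: cvgM; [exact: cvg_cst | apply: continuous_negXV; rewrite inE/=].
  exact: le_lt_trans y0.
have H z : `[x, y]%classic z ->
    normal_pdf 0 1 z <= - (2 * (2 * normal_peak 1)) * z ^- 3.
  rewrite /= in_itv/= => /andP[_ zy].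
  have := normal_pdf01_le (le_lt_trans zy y0).
  by rewrite mulrA -natrM.
apply: ge0_le_integral => //=.
- by move=> z _; rewrite lee_fin normal_pdf_ge0.
- by apply/measurable_EFinP; apply: measurable_funTS; exact: measurable_normal_pdf.
- exact/measurable_EFinP.
Qed.

Lemma normal_cdf_cvgNy : normal_cdf x @[x --> -oo] --> 0.
Proof.
(* Under [normal_prob 0 1] the identity is a random variable whose distribution function is
   [normal_cdf]. *)
pose X0 : measurableTypeR R -> R := idfun.
have mX0 : measurable_fun setT X0 by exact: measurable_id.
pose N : probability (measurableTypeR R) R := normal_prob 0 1.
pose X : {RV N >-> R} := HB.pack X0 (isMeasurableFun.Build _ _ _ _ X0 mX0).
have := cvg_cdfNy0 X.
move/fine_cvg => /=.
by apply: cvg_trans; apply: near_eq_cvg; near=> x.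
Unshelve. all: by end_near. Qed.

Lemma normal_cdf_ge0 x : 0 <= normal_cdf x. Proof. exact: fine_ge0. Qed.

(** Limit of [normal_cdf_increment] as the left end goes to [-oo]; it covers the degenerate end
    [u = 0] of the Lipschitz bound. *)
Lemma normal_cdf_le y : y < 0 -> normal_cdf y <= 2 * normal_peak 1 * y ^- 2.
Proof.
move=> y0; rewrite -[leRHS]add0r.
apply: (@ler_cvg_to _ (ninfty_nbhs R) _ _ (cst (normal_cdf y))
  (fun x => normal_cdf x + 2 * normal_peak 1 * y ^- 2) (normal_cdf y)); first exact: cvg_cst.
  by apply: cvgD; [exact: normal_cdf_cvgNy | exact: cvg_cst].
near=> x; have xy : x < y by near: x; apply: nbhs_ninfty_lt; rewrite num_real.
have /andP[_ /le_trans ->]// := normal_cdf_increment xy y0.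
rewrite lerD2l ler_wpM2l ?mulr_ge0 ?normal_peak_ge0// lerBlDr lerDl.
by rewrite invr_ge0 sqr_ge0.
Unshelve. all: by end_near. Qed.

(* At [u = 0] the division would give [normal_cdf 0] instead of the limit [0]. *)
Definition error_rate u : R := if u == 0 then 0 else normal_cdf (- (Num.sqrt u)^-1).

(** At [y = - (Num.sqrt v)^-1] the inverse square [y ^- 2] is [v] itself, so the bound by inverse
    squares becomes linear in [v - u]. *)
Lemma error_rate_incr u v : 0 <= u <= v ->
  error_rate u <= error_rate v <= error_rate u + 2 * normal_peak 1 * (v - u).
Proof.
move=> /andP[u0 uv]; have v0 := le_trans u0 uv.
have [->|uv'] := eqVneq u v; first by rewrite subrr mulr0 addr0 lexx.
have {uv uv'} uv : u < v by rewrite lt_neqAle uv'.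
have {}v0 : 0 < v by exact: le_lt_trans uv.
have sv : - (Num.sqrt v)^-1 < 0 by rewrite oppr_lt0 invr_gt0 sqrtr_gt0.
have e (w : R) : 0 <= w -> (- (Num.sqrt w)^-1) ^- 2 = w.
  by move=> w0; rewrite sqrrN exprVn invrK sqr_sqrtr.
rewrite /error_rate (gt_eqF v0); case: ifPn => [/eqP ->|un0].
  by rewrite normal_cdf_ge0 add0r subr0 -{2}(e _ (ltW v0)) normal_cdf_le.
have {un0}u0 : 0 < u by rewrite lt_neqAle eq_sym un0.
rewrite -{3}(e _ (ltW v0)) -{3}(e _ (ltW u0)) normal_cdf_increment//.
by rewrite ltrN2 ltf_pV2 ?posrE ?sqrtr_gt0// ltr_sqrt.
Qed.

Lemma error_rate_lip u v : 0 <= u -> 0 <= v ->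
  `|error_rate u - error_rate v| <= 2 * normal_peak 1 * `|u - v|.
Proof.
wlog uv : u v / u <= v => [hw u0 v0|u0 v0].
  have [/hw|/ltW /hw] := leP u v; first exact.
  by rewrite distrC (distrC u); exact.
have /error_rate_incr/andP[h1 h2] : 0 <= u <= v by rewrite u0.
rewrite ler0_norm ?subr_le0// opprB (ler0_norm (_ : u - v <= 0)) ?subr_le0//.
by rewrite opprB lerBlDl.
Qed.

(** Substitution [t -> s * t + m]; its derivative [s] cancels the [s^-1] in the peak of the
    density. *)
Lemma normal_prob_affine m s k : 0 < s ->
  normal_prob m s `]-oo, k] = normal_prob 0 1 `]-oo, (k - m) / s].
Proof.
move=> s0; pose F := fun t : R => s * t + m.
have dF (x : R) : is_derive x 1 F s.
  by apply: is_derive_eq; rewrite /GRing.scale/= !(addr0,mulr1,add0r).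
have F'E : derive1 F = cst s.
  by apply/funext => x; rewrite derive1E derive_val.
have Fk : F ((k - m) / s) = k by rewrite /F; field; rewrite gt_eqF.
have cF : continuous F by move=> x; apply/differentiable_continuous/derivable1_diffP.
rewrite /normal_prob -{1}Fk (@increasing_ge0_integration_by_substitutionNy _ F).
- apply: eq_integral => x _; congr EFin; rewrite F'E /= !normal_pdfE ?oner_eq0 ?gt_eqF//.
  rewrite /normal_fun /normal_peak /F !fctE /= addrK subr0 expr1n mul1r.
  rewrite mulrAC; congr (_ * _).
    rewrite -mulrnAr sqrtrM ?sqr_ge0// sqrtr_sqr gtr0_norm// invfM mulrAC mulVf ?mul1r//.
    by rewrite gt_eqF.
  congr expR; field; rewrite gt_eqF//.
- by move=> x y _ _ xy; rewrite /F ltrD2r ltr_pM2l.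
- by move=> x _; rewrite F'E; exact: cvg_cst.
- by rewrite F'E; exact: is_cvg_cst.
- by rewrite F'E; exact: cvg_cst.
- split; first by move=> x _; exact: ex_derive.
  exact/cvg_at_left_filter/cF.
- apply/cvgrNyPle => A; near=> x; rewrite /F -lerBrDr mulrC -ler_pdivlMr//.
- apply: continuous_subspaceT; apply: continuous_normal_pdf; by rewrite gt_eqF.
- by move=> x _; exact: normal_pdf_ge0.
Unshelve. all: by end_near. Qed.

(** For [v = 0] the point mass at [m] misses the half-line because [k < m], in agreement with the
    value [0] of [error_rate] at [0]. *)
Lemma gauss_law_le m v k : 0 <= v -> k < m ->
  gauss_law m v `]-oo, k] = (error_rate (v / (m - k) ^+ 2))%:E.
Proof.
move=> v0 km; have mk : 0 < m - k by rewrite subr_gt0.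
rewrite /gauss_law /error_rate mulf_eq0 invr_eq0 expf_eq0/= (gt_eqF mk) orbF.
case: ifPn => [_|vn0]; first by rewrite diracE memNset//= in_itv/= leNgt km.
have {vn0}v0' : 0 < v by rewrite lt_neqAle eq_sym vn0.
have s0 : 0 < Num.sqrt v by rewrite sqrtr_gt0.
rewrite normal_prob_affine// normal_cdfE sqrtrM// sqrtrV ?sqr_ge0//.
rewrite sqrtr_sqr gtr0_norm// (_ : (k - m) / Num.sqrt v = - (Num.sqrt v / (m - k))^-1) //.
by field; rewrite !gt_eqF.
Qed.

(** Ties go to group 1, so the error event is an open half-line for group 1 and a closed one for
    group 2; this removes the difference. *)
Lemma gauss_law_lt m v k : 0 <= v -> k < m ->
  gauss_law m v `]-oo, k[ = gauss_law m v `]-oo, k].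
Proof.
move=> v0 km; rewrite /gauss_law.
case: ifPn => [_|vn0].
  by rewrite !diracE !memNset//= in_itv/= ?leNgt ?km// ltNge ltW.
rewrite /normal_prob integral_itv_bndo_bndc//.
by apply/measurable_EFinP; apply: measurable_funTS; exact: measurable_normal_pdf.
Qed.

End gauss.

(** * Norm inequalities, quadratic forms and perturbation of feasible points *)

Section linear_algebra.
Variable R : realType.
Variable p : nat.
Implicit Types (u v w md : 'cV[R]_p) (S : 'M[R]_p) (c e t k : R).

Lemma dotvDl u v w : dotv (u + v) w = dotv u w + dotv v w.
Proof.
by rewrite /dotv -big_split; apply: eq_bigr => i _; rewrite mxE mulrDl.
Qed.

Lemma dotvDr u v w : dotv w (u + v) = dotv w u + dotv w v.
Proof.
by rewrite /dotv -big_split; apply: eq_bigr => i _; rewrite mxE mulrDr.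
Qed.

Lemma dotvZl k u w : dotv (k *: u) w = k * dotv u w.
Proof. by rewrite /dotv mulr_sumr; apply: eq_bigr => i _; rewrite mxE mulrA. Qed.

Lemma dotvZr k u w : dotv w (k *: u) = k * dotv w u.
Proof. by rewrite /dotv mulr_sumr; apply: eq_bigr => i _; rewrite mxE mulrCA. Qed.

Lemma dotvNl u w : dotv (- u) w = - dotv u w.
Proof. by rewrite -scaleN1r dotvZl mulN1r. Qed.

Lemma dotvBr u v w : dotv w (u - v) = dotv w u - dotv w v.
Proof. by rewrite dotvDr -scaleN1r dotvZr mulN1r. Qed.

Lemma norm1_ge0 u : 0 <= norm1 u. Proof. exact: sumr_ge0. Qed.

Lemma norm1D u v : norm1 (u + v) <= norm1 u + norm1 v.
Proof.
by rewrite /norm1 -big_split; apply: ler_sum => i _; rewrite mxE ler_normD.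
Qed.

Lemma norm1Z k u : norm1 (k *: u) = `|k| * norm1 u.
Proof. by rewrite /norm1 mulr_sumr; apply: eq_bigr => i _; rewrite mxE normrM. Qed.

Lemma normInfv_ge u i : `|u i 0| <= normInfv u.
Proof. by apply: (le_bigmax _ (fun i => `|u i 0|)). Qed.

Lemma normInfv_ge0 u : 0 <= normInfv u.
Proof. by apply: bigmax_ge_id. Qed.

Lemma normInfv_le u e : 0 <= e -> (forall i, `|u i 0| <= e) -> normInfv u <= e.
Proof. by move=> e0 ue; apply: bigmax_le. Qed.

Lemma normInfvD u v : normInfv (u + v) <= normInfv u + normInfv v.
Proof.
apply: normInfv_le => [|i]; first by rewrite addr_ge0 ?normInfv_ge0.
by rewrite mxE (le_trans (ler_normD _ _))// lerD ?normInfv_ge.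
Qed.

Lemma normInfvZ k u : normInfv (k *: u) <= `|k| * normInfv u.
Proof.
apply: normInfv_le => [|i]; first by rewrite mulr_ge0 ?normInfv_ge0.
by rewrite mxE normrM ler_wpM2l ?normInfv_ge.
Qed.

Lemma normInfvN u : normInfv (- u) = normInfv u.
Proof. by rewrite /normInfv; apply: eq_bigr => i _; rewrite mxE normrN. Qed.

Lemma normInfm_ge S i j : `|S i j| <= normInfm S.
Proof.
apply: le_trans (le_bigmax _ (fun i => \big[Num.max/0]_(j < p) `|S i j|) i).
by apply: (le_bigmax _ (fun j => `|S i j|)).
Qed.

Lemma normInfm_ge0 S : 0 <= normInfm S.
Proof. by apply: bigmax_ge_id. Qed.

Lemma normr_dotv_le u v : `|dotv u v| <= norm1 u * normInfv v.
Proof.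
rewrite /dotv (le_trans (ler_norm_sum _ _ _))// /norm1 mulr_suml.
by apply: ler_sum => i _; rewrite normrM ler_wpM2l ?normInfv_ge.
Qed.

(** The polar form of [quadf]: changes of [quadf] in the vector or in the matrix are values of it,
    all bounded by [normr_bilin_le]. *)
Definition bilin S u v : R := \sum_(i < p) \sum_(j < p) u i 0 * S i j * v j 0.

Lemma normr_bilin_le S u v : `|bilin S u v| <= norm1 u * normInfm S * norm1 v.
Proof.
rewrite /bilin (le_trans (ler_norm_sum _ _ _))// /norm1 !mulr_suml.
apply: ler_sum => i _; rewrite (le_trans (ler_norm_sum _ _ _))// mulr_sumr.
by apply: ler_sum => j _; rewrite !normrM ler_wpM2r// ler_wpM2l ?normInfm_ge.
Qed.

Lemma quadf_sub S u w : quadf S u - quadf S w = bilin S (u - w) u + bilin S w (u - w).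
Proof.
rewrite /quadf /bilin -sumrB -big_split; apply: eq_bigr => i _.
rewrite -sumrB -big_split; apply: eq_bigr => j _; rewrite !mxE/=.
by ring.
Qed.

Lemma quadf_mxsub S1 S2 w : quadf S1 w - quadf S2 w = bilin (S1 - S2) w w.
Proof.
rewrite /quadf /bilin -sumrB; apply: eq_bigr => i _.
rewrite -sumrB; apply: eq_bigr => j _; rewrite !mxE/=.
by ring.
Qed.

Lemma quadf_le S w c : norm1 w <= c -> `|quadf S w| <= c ^+ 2 * normInfm S.
Proof.
move=> wc; apply: le_trans (normr_bilin_le S w w) _.
rewrite mulrAC -expr2 ler_wpM2r ?normInfm_ge0//.
by rewrite lerXn2r ?nnegrE ?norm1_ge0// (le_trans _ wc) ?norm1_ge0.
Qed.

(** The witness is the coordinate vector at a largest entry of [md], divided by that entry. *)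
Lemma feasible_peak md : 0 < normInfv md ->
  exists2 w, dotv w md = 1 & norm1 w = (normInfv md)^-1.
Proof.
move=> md0.
(* The maximum starts from the default [0]; as it is positive, it must be attained at some
   coordinate. *)
have [i mdi] : exists i, normInfv md = `|md i 0|.
  apply/not_existsP => H; suff : normInfv md < normInfv md by rewrite ltxx.
  apply: bigmax_lt => // i _.
  by rewrite lt_neqAle normInfv_ge andbT eq_sym; apply/eqP/H.
have mdi0 : md i 0 != 0 by rewrite -normr_gt0 -mdi.
exists ((md i 0)^-1 *: delta_mx i 0).
  rewrite dotvZl /dotv (bigD1 i)//= mxE !eqxx mul1r big1 ?addr0 ?mulVf//.
  by move=> j /negbTE ji; rewrite mxE ji mul0r.
rewrite norm1Z normfV -mdi /norm1 (bigD1 i)//= mxE !eqxx normr1 big1 ?addr0 ?mulr1//.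
by move=> j /negbTE ji; rewrite mxE ji normr0.
Qed.

(* With [tau] the defect [w^T md' - 1], the point [w' = (w + (s - tau) w0) / (1 + s)]
   meets the new equality constraint, and the slack [eta] of [w0] absorbs the excess
   of its l1 norm as soon as [s >= c |tau| / eta]. *)
Lemma feasible_perturb c eta t md' w w0 :
  0 < eta -> eta <= c -> norm1 w <= c -> `|dotv w md' - 1| <= t ->
  norm1 w0 <= c - eta -> dotv w0 md' = 1 ->
  exists2 w', road_feasible c md' w' & norm1 (w' - w) <= 3 * c * (c * t / eta).
Proof.
move=> eta0 etac wc; set tau := _ - 1 => taut w0c w01.
have t0 : 0 <= t by exact: le_trans taut.
set s := c * t / eta.
have c0 : 0 < c by exact: lt_le_trans etac.
have ts : t <= s by rewrite /s ler_pdivlMr// mulrC ler_wpM2r.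
have seta : s * eta = c * t by rewrite /s divfK// gt_eqF.
have s1 : 0 < 1 + s by lra.
have /andP[tau1 tau2] : - t <= tau <= t by rewrite -ler_norml.
have [n1 n2] := (norm1_ge0 w, norm1_ge0 w0).
exists ((1 + s)^-1 *: (w + (s - tau) *: w0)); first split.
- rewrite norm1Z ger0_norm ?invr_ge0 ?(ltW s1)// ler_pdivrMl//.
  rewrite (le_trans (norm1D _ _))// norm1Z ger0_norm; last lra.
  have : (s - tau) * norm1 w0 <= (s - tau) * (c - eta) by rewrite ler_wpM2l//; lra.
  have : - tau * (c - eta) <= t * (c - eta) by rewrite ler_wpM2r//; lra.
  have : 0 <= t * eta by rewrite mulr_ge0// ltW.
  nra.
- rewrite dotvZl dotvDl dotvZl w01 mulr1 (_ : dotv w md' = 1 + tau); last by rewrite /tau; ring.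
  by field; rewrite gt_eqF.
rewrite (_ : _ - w = (1 + s)^-1 *: ((- s) *: w + (s - tau) *: w0)); last first.
  apply/matrixP => i j; rewrite !mxE; field; by rewrite gt_eqF.
rewrite norm1Z ger0_norm ?invr_ge0 ?(ltW s1)// ler_pdivrMl//.
rewrite (le_trans (norm1D _ _))// !norm1Z normrN !ger0_norm; [|lra|lra].
(* From [|tau| <= t <= s] the two coefficients are at most [s] and [2 * s], which gives the factor
   [3]; the division by [1 + s] only helps. *)
have : s * norm1 w <= s * c by rewrite ler_wpM2l//; lra.
have : (s - tau) * norm1 w0 <= (s + s) * c by rewrite ler_pM//; lra.
have s0 : 0 <= s by lra.
have : 0 <= s * (3 * c * s).
  by rewrite mulr_ge0// mulr_ge0// mulr_ge0// ltW.
by lra.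
Qed.

Lemma quadf_perturb S c k u w :
  norm1 u <= c -> norm1 w <= c -> norm1 (u - w) <= k ->
  quadf S u <= quadf S w + 2 * k * c * normInfm S.
Proof.
move=> uc wc uwk; rewrite -lerBlDl quadf_sub.
have S0 := normInfm_ge0 S.
have h v : norm1 v <= c -> norm1 (u - w) * normInfm S * norm1 v <= k * c * normInfm S.
  move=> vc; rewrite mulrAC ler_wpM2r// ler_pM ?norm1_ge0//.
rewrite (le_trans (ler_norm _))// (le_trans (ler_normD _ _))//.
have h1 := le_trans (normr_bilin_le S (u - w) u) (h _ uc).
have h2 : `|bilin S w (u - w)| <= k * c * normInfm S.
  apply: le_trans (normr_bilin_le S w (u - w)) _.
  by rewrite (_ : _ * _ = norm1 (u - w) * normInfm S * norm1 w) ?h//; ring.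
by lra.
Qed.

End linear_algebra.

(** * Misclassification rate of a linear rule in closed form *)

Section misclassification.
Variables (R : realType) (d : measure_display) (T : measurableType d).
Variables (p : nat) (Q : probability T R) (Y : T -> nat) (X : T -> 'cV[R]_p).
Variables (mu1 mu2 : 'cV[R]_p) (S : 'M[R]_p).
Hypothesis hobs : two_class_normal Q Y X mu1 mu2 S.
Implicit Types w m : 'cV[R]_p.

(** [Y] takes values in [nat]; a label other than 1 and 2 is always an error, and such labels are
    shown to have probability zero. *)
Let rest := ~` ([set t | Y t = 1%N] `|` [set t | Y t = 2%N]).

Let mY i : measurable [set t | Y t = i]. Proof. by case: hobs. Qed.

Let mrest : measurable rest. Proof. by apply: measurableC; apply: measurableU. Qed.

Let mX w (B : set R) : measurable B -> measurable [set t | B (dotv w (X t))].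
Proof.
by case: hobs => _ [h _] mB; rewrite -[X in measurable X]setTI; exact: h.
Qed.

Let gauss_law_setT (m v : R) : gauss_law m v setT = 1%E.
Proof.
rewrite /gauss_law; case: ifP => _; first by rewrite diracT.
exact: (probability_setT (normal_prob m (Num.sqrt v))).
Qed.

Let Q_rest : Q rest = 0%E.
Proof.
have [_ [_ [h1 h2]]] := hobs.
(* The trivial event [B = setT] turns the conditional laws into [Q (Y = i) = 1 / 2]. *)
have := h1 0 setT measurableT; have := h2 0 setT measurableT.
rewrite !gauss_law_setT !mule1 !setIT => q2 q1.
rewrite /rest probability_setC; last exact: measurableU.
have -> : Q ([set t | Y t = 1%N] `|` [set t | Y t = 2%N]) = 1%E.
  rewrite measureU//; last by rewrite -subset0 => t [/= ->].
  by rewrite [X in (X + _)%E]q1 [X in (_ + X)%E]q2 -EFinD; congr EFin; lra.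
by rewrite subee.
Qed.

(** Passing to [- w] for group 2 makes both error events lower half-lines, so one tail formula
    serves both groups. *)
Let misclass_setE w m : [set t | lin_rule w m (X t) <> Y t] =
  ([set t | Y t = 1%N] `&` [set t | `]-oo, dotv w m[%classic (dotv w (X t))]) `|`
  ([set t | Y t = 2%N] `&` [set t | `]-oo, dotv (- w) m]%classic (dotv (- w) (X t))])
  `|` rest.
Proof.
apply/seteqP; split => t /=;
  rewrite /rest/= /lin_rule !in_itv/= !dotvNl lerN2 dotvBr subr_lt0.
- have [y1|/eqP n1] := eqVneq (Y t) 1%N.
    by rewrite y1; case: ifP => // h _; left; left.
  have [y2|/eqP n2] := eqVneq (Y t) 2%N.
    by rewrite y2; case: ifP => // h _; left; right; rewrite leNgt h.
  by move=> _; right => -[].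
- move=> [[[-> ->]//|[-> ]]|h].
    by rewrite leNgt => /negbTE ->.
  by case: ifP => _ e; apply: h; [right|left].
Qed.

Lemma measurable_misclass w m : measurable [set t | lin_rule w m (X t) <> Y t].
Proof.
by rewrite misclass_setE; apply: measurableU => //; apply: measurableU;
  apply: measurableI => //; exact: mX.
Qed.

Lemma misclass_ge0 w m : 0 <= misclass Q Y X (lin_rule w m).
Proof. exact: fine_ge0. Qed.

Lemma misclass_le1 w m : misclass Q Y X (lin_rule w m) <= 1.
Proof.
rewrite -lee_fin /misclass fineK ?fin_num_measure//; last exact: measurable_misclass.
by apply: probability_le1; exact: measurable_misclass.
Qed.

(** The threshold lies strictly between the projected means, so each group contributes half of a
    normal tail with its own separation. *)
Lemma misclassE w m : 0 <= quadf S w ->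
  dotv w m < dotv w mu1 -> dotv w mu2 < dotv w m ->
  misclass Q Y X (lin_rule w m) =
    (error_rate (quadf S w / (dotv w mu1 - dotv w m) ^+ 2) +
     error_rate (quadf S w / (dotv w m - dotv w mu2) ^+ 2)) / 2.
Proof.
move=> v0 m1 m2; have [_ [_ [h1 h2]]] := hobs.
have vN : quadf S (- w) = quadf S w.
  by apply: eq_bigr => i _; apply: eq_bigr => j _; rewrite !mxE !mulNr mulrN opprK.
have mE1 : measurable ([set t | Y t = 1%N] `&`
    [set t | `]-oo, dotv w m[%classic (dotv w (X t))]).
  by apply: measurableI => //; exact: mX.
have mE2 : measurable ([set t | Y t = 2%N] `&`
    [set t | `]-oo, dotv (- w) m]%classic (dotv (- w) (X t))]).
  by apply: measurableI => //; exact: mX.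
rewrite /misclass misclass_setE measureU//; last 2 first.
- exact: measurableU.
- rewrite -subset0 => t [[[/= e _]|[/= e _]]]; rewrite /rest /= e => h.
  by apply: h; left.
  by apply: h; right.
rewrite measureU//; last first.
  by rewrite -subset0 => t [[/= -> _] [/=]].
rewrite [X in (X + _)%E](_ : _ =
    ((1 / 2)%:E * (error_rate (quadf S w / (dotv w mu1 - dotv w m) ^+ 2))%:E +
     (1 / 2)%:E * (error_rate (quadf S w / (dotv w m - dotv w mu2) ^+ 2))%:E)%E).
  by rewrite [X in (_ + X)%E]Q_rest adde0/= !mul1r -mulrDr mulrC.
congr (_ + _)%E; first by apply: etrans (h1 _ _ _) _ => //;
  rewrite gauss_law_lt// gauss_law_le.
apply: etrans (h2 _ _ _) _ => //.
by rewrite vN gauss_law_le ?dotvNl ?ltrN2// opprK (addrC (- _)).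
Qed.

End misclassification.

(** * Deterministic comparison of the two rules when all estimation errors are at most [e] *)

Section road.
Variables (R : realType) (d : measure_display) (T : measurableType d).
Variables (p : nat) (Q : probability T R) (Y : T -> nat) (X : T -> 'cV[R]_p).
Variables (mu1 mu2 mu1h mu2h wc wh : 'cV[R]_p) (S Sh : 'M[R]_p) (c eps e : R).
Local Notation md := (halfdiff mu1 mu2).
Local Notation mdh := (halfdiff mu1h mu2h).
Local Notation K := (2 * @normal_peak R 1).

Hypothesis hS : is_covariance S.
Hypothesis hobs : two_class_normal Q Y X mu1 mu2 S.
Hypothesis eps0 : 0 < eps.
Hypothesis hmd : eps < normInfv md.
Hypothesis hc : eps + (normInfv md)^-1 < c.
Hypothesis hSh : normInfm (Sh - S) <= e.
Hypothesis hmu1 : normInfv (mu1h - mu1) <= e.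
Hypothesis hmu2 : normInfv (mu2h - mu2) <= e.
Hypothesis e_eps : e <= eps / 2.
Hypothesis e_eps3 : e <= eps ^+ 3 / 4.
Hypothesis hwc : road_argmin c md S wc.
Hypothesis hwh : (exists w, road_feasible c mdh w) -> road_argmin c mdh Sh wh.

Let e0 : 0 <= e. Proof. exact: le_trans (normInfv_ge0 _) hmu1. Qed.

Let md0 : 0 < normInfv md. Proof. exact: lt_trans hmd. Qed.

Let eps_c : eps < c.
Proof. by apply: le_lt_trans hc; rewrite lerDl invr_ge0 ltW. Qed.

Let c0 : 0 < c. Proof. exact: lt_trans eps_c. Qed.

Let halfdiff_close : normInfv (mdh - md) <= e.
Proof.
rewrite (_ : _ - _ = 2^-1 *: ((mu1h - mu1) + - (mu2h - mu2))); last first.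
  by apply/matrixP => i j; rewrite !mxE; ring.
rewrite (le_trans (normInfvZ _ _))// ger0_norm ?invr_ge0// ler_pdivrMl//.
rewrite (le_trans (normInfvD _ _))// normInfvN.
by have := hmu1; have := hmu2; lra.
Qed.

Let slack : exists2 w, dotv w md = 1 & norm1 w <= c - eps / 2.
Proof.
have [w w1 wn] := feasible_peak md0; exists w => //.
by rewrite wn; have := hc; have := eps0; lra.
Qed.

(** Since [normInfv mdh >= eps / 2], replacing [md] by [mdh] raises the inverse norm by at most
    [e / (eps ^+ 2 / 2)], which [e_eps3] bounds by [eps / 2]: half of the original margin
    survives. *)
Let slack_hat : exists2 w, dotv w mdh = 1 & norm1 w <= c - eps / 2.
Proof.
have h : normInfv md <= normInfv mdh + e.
  rewrite -[X in normInfv X <= _](subKr mdh) (le_trans (normInfvD _ _))//.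
  by rewrite normInfvN lerD2l.
have mdh_eps : eps / 2 <= normInfv mdh by have := hmd; have := e_eps; lra.
have mdh0 : 0 < normInfv mdh by apply: lt_le_trans mdh_eps; rewrite divr_gt0.
have [w w1 wn] := feasible_peak mdh0; exists w => //; rewrite wn.
suff : (normInfv mdh)^-1 <= (normInfv md)^-1 + eps / 2 by have := hc; lra.
rewrite -lerBlDl (_ : _ - _ = (normInfv md - normInfv mdh) /
  (normInfv md * normInfv mdh)); last by field; rewrite !gt_eqF.
rewrite ler_pdivrMr ?mulr_gt0//.
have : eps * (eps / 2) <= normInfv md * normInfv mdh.
  by rewrite ler_pM ?divr_ge0// ltW.
have h2 : 0 <= eps / 2 by rewrite divr_ge0// ltW.
move/(ler_wpM2l h2); apply: le_trans; rewrite (_ : eps / 2 * _ = eps ^+ 3 / 4); last by field.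
by have := e_eps3; lra.
Qed.

Let hwh' : road_argmin c mdh Sh wh.
Proof.
apply: hwh; have [w w1 wn] := slack_hat; exists w; split => //.
by apply: le_trans wn _; rewrite gerBl divr_ge0// ltW.
Qed.

Let v := quadf S wc.
Let vh := quadf S wh.
Let sig := normInfm S.

Let wcc : norm1 wc <= c. Proof. by case: hwc => -[]. Qed.
Let whc : norm1 wh <= c. Proof. by case: hwh' => -[]. Qed.

Let dotv_close (w u : 'cV[R]_p) : norm1 w <= c -> normInfv u <= e -> `|dotv w u| <= c * e.
Proof.
move=> wn un; apply: le_trans (normr_dotv_le _ _) _.
by rewrite ler_pM ?norm1_ge0 ?normInfv_ge0.
Qed.

Let perturb (u md' w w0 : 'cV[R]_p) : norm1 w <= c -> dotv w u = 1 -> normInfv (md' - u) <= e ->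
  norm1 w0 <= c - eps / 2 -> dotv w0 md' = 1 ->
  exists2 w', road_feasible c md' w' &
    quadf S w' <= quadf S w + 12 * c ^+ 4 * e * sig / eps.
Proof.
move=> wn wu ue w0n w01; have eps20 : 0 < eps / 2 by rewrite divr_gt0.
have eps2c : eps / 2 <= c by have := eps_c; have := eps0; lra.
have wt : `|dotv w md' - 1| <= c * e by rewrite -wu -dotvBr dotv_close.
(* Margin [eps / 2] and defect [c * e] give l1 distance [6 * c ^+ 3 * e / eps]; [quadf_perturb]
   multiplies it by [2 * c * sig]. *)
have [w' fw' ww'] := feasible_perturb eps20 eps2c wn wt w0n w01.
exists w' => //; case: fw' => w'n _.
apply: le_trans (quadf_perturb S w'n wn ww') _.
rewrite lerD2l -/sig le_eqVlt; apply/orP; left; apply/eqP.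
by field; rewrite gt_eqF.
Qed.

(** Each minimizer is compared with a feasible perturbation of the other. The bound on [vh] switches
    between [S] and [Sh] twice, at cost [c ^+ 2 * e] each; the bound on [v] uses [S] only. *)
Let variance_close : `|vh - v| <= 2 * c ^+ 2 * e + 12 * c ^+ 4 * e * sig / eps.
Proof.
have [[_ wc1] wcmin] := hwc; have [[_ wh1] whmin] := hwh'.
have c2e : 0 <= c ^+ 2 * e by rewrite mulr_ge0// sqr_ge0.
have Shclose (w : 'cV[R]_p) : norm1 w <= c -> `|quadf Sh w - quadf S w| <= c ^+ 2 * e.
  move=> wn; rewrite quadf_mxsub (le_trans (quadf_le _ wn))//.
  by rewrite ler_wpM2l ?sqr_ge0.
have [w0 w01 w0n] := slack; have [w0h w0h1 w0hn] := slack_hat.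
have halfdiff_close' : normInfv (md - mdh) <= e by rewrite -opprB normInfvN.
have [w1 fw1 hw1] := perturb wcc wc1 halfdiff_close w0hn w0h1.
have [w2 fw2 hw2] := perturb whc wh1 halfdiff_close' w0n w01.
rewrite /v /vh; move: hw1 hw2 c2e (Shclose _ whc) (Shclose _ fw1.1).
by move: (whmin _ fw1) (wcmin _ fw2); rewrite !ler_norml; lra.
Qed.

Lemma road_misclass_close :
  `|misclass Q Y X (lin_rule wh (halfsum mu1h mu2h)) -
    misclass Q Y X (lin_rule wc (halfsum mu1 mu2))| <=
  (K * (8 + 58 / eps) + 2 / eps) * (c ^+ 2 * e * (1 + c ^+ 2 * normInfm S)).
Proof.
rewrite -/sig.
have sig0 : 0 <= sig := normInfm_ge0 S.
have K0 : 0 <= K by rewrite mulr_ge0 ?normal_peak_ge0.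
have c0' : 0 <= c := ltW c0.
have c2 : 0 <= c ^+ 2 := sqr_ge0 c.
have ie0 : 0 <= eps^-1 by rewrite invr_ge0 ltW.
(* Here [eps < c] trades a factor [c] for [eps], since the target rate contains [c ^+ 2 * e]. *)
have ce : c * e <= c ^+ 2 * e / eps.
  rewrite ler_pdivlMr// expr2 mulrAC ler_wpM2r// ler_wpM2l ?ltW//.
have ce0 : 0 <= c * e by rewrite mulr_ge0 // ltW.
set D := c ^+ 2 * e * (1 + _).
have c2e_D : c ^+ 2 * e <= D.
  by rewrite /D mulrDr mulr1 lerDl !mulr_ge0.
have c4e_D : c ^+ 2 * e * (c ^+ 2 * sig) <= D.
  by rewrite /D mulrDr mulr1 lerDr mulr_ge0.
have D0 : 0 <= D by apply: le_trans c2e_D; rewrite mulr_ge0.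
have KD : 0 <= K * (8 + 58 / eps) * D.
  by apply: mulr_ge0 => //; apply: mulr_ge0 => //; rewrite addr_ge0 // mulr_ge0.
(* If [c * e > 1 / 2], the trivial bound [1] on the difference is below [2 * (c * e)]; this is the
   source of the summand [2 / eps]. Otherwise all separations are at least [1 / 2]. *)
have [ce2|ce2] := ltP (1 / 2) (c * e).
  apply: (@le_trans _ _ 1).
    have := misclass_ge0 Q Y X wh (halfsum mu1h mu2h).
    have := misclass_ge0 Q Y X wc (halfsum mu1 mu2).
    have := misclass_le1 hobs wh (halfsum mu1h mu2h).
    have := misclass_le1 hobs wc (halfsum mu1 mu2).
    by rewrite ler_norml; lra.
  rewrite mulrDl; have : c ^+ 2 * e / eps <= D / eps by rewrite ler_wpM2r.
  by rewrite (_ : 2 / eps * D = 2 * (D / eps)); [lra | ring].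
have [[_ wc1] _] := hwc; have [[_ wh1] _] := hwh'.
have halfsum1 (x y : 'cV[R]_p) : halfsum x y = x - halfdiff x y.
  by apply/matrixP => i j; rewrite !mxE; field.
have halfsum2 (x y : 'cV[R]_p) : halfsum x y = y + halfdiff x y.
  by apply/matrixP => i j; rewrite !mxE; field.
pose e1 := dotv wh (mu1h - mu1); pose e2 := dotv wh (mu2h - mu2).
have e1c : `|e1| <= c * e by exact: dotv_close.
have e2c : `|e2| <= c * e by exact: dotv_close.
have m1 : dotv wh mu1 - dotv wh (halfsum mu1h mu2h) = 1 - e1.
  by rewrite halfsum1 /e1 !dotvBr wh1; ring.
have m2 : dotv wh (halfsum mu1h mu2h) - dotv wh mu2 = 1 + e2.
  by rewrite halfsum2 /e2 !dotvBr dotvDr wh1; ring.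
have n1 : dotv wc mu1 - dotv wc (halfsum mu1 mu2) = 1.
  by rewrite halfsum1 !dotvBr wc1; ring.
have n2 : dotv wc (halfsum mu1 mu2) - dotv wc mu2 = 1.
  by rewrite halfsum2 dotvDr wc1; ring.
have v0 : 0 <= v := hS.2 wc.
have vh0 : 0 <= vh := hS.2 wh.
have vle : v <= c ^+ 2 * sig by apply: le_trans (ler_norm _) (quadf_le S wcc).
(* The ROAD separations have the form [1 + s], the oracle ones equal [1]. The factor [4] bounds
   [(1 + s) ^- 2]; then [8 = 4 * 2] and [58 = 4 * (12 + 5 / 2)]. *)
have ratio s : `|s| <= c * e ->
    `|error_rate (vh / (1 + s) ^+ 2) - error_rate v| <= K * (8 + 58 / eps) * D.
  move=> sce; have := sce; rewrite ler_norml => /andP[s1 s2].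
  have s12 : 1 / 2 <= 1 + s by lra.
  have q0 : 0 < (1 + s) ^+ 2 by rewrite exprn_gt0//; lra.
  have q4 : ((1 + s) ^+ 2)^-1 <= 4.
    rewrite invf_ple ?posrE// (le_trans _ (_ : (1 / 2) ^+ 2 <= _)) ?lerXn2r ?nnegrE//; lra.
  apply: le_trans (error_rate_lip _ v0) _; first by rewrite divr_ge0// ltW.
  rewrite -[leRHS]mulrA ler_wpM2l//.
  rewrite (_ : _ - v = ((vh - v) - v * (s * (2 + s))) * ((1 + s) ^+ 2)^-1); last first.
    by field; rewrite gt_eqF//; lra.
  have q0i : 0 <= ((1 + s) ^+ 2)^-1 by rewrite invr_ge0 ltW.
  rewrite normrM (ger0_norm q0i).
  apply: (@le_trans _ _ (`|vh - v - v * (s * (2 + s))| * 4)); first by rewrite ler_wpM2l.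
  have hs : `|s * (2 + s)| <= c * e * (5 / 2).
    rewrite normrM ler_pM// ler_norml; lra.
  have hv : `|v * (s * (2 + s))| <= c ^+ 2 * sig * (c ^+ 2 * e / eps * (5 / 2)).
    rewrite normrM ger0_norm// ler_pM// (le_trans hs)// ler_wpM2r//; lra.
  have := le_trans (ler_normB _ _) (lerD variance_close hv).
  set A := `|_|.
  have : c ^+ 2 * e * (c ^+ 2 * sig) / eps <= D / eps by rewrite ler_wpM2r.
  rewrite (_ : 12 * c ^+ 4 * e * sig / eps = 12 * (c ^+ 2 * e * (c ^+ 2 * sig) / eps)); last by ring.
  rewrite (_ : c ^+ 2 * sig * (c ^+ 2 * e / eps * (5 / 2)) =
    5 / 2 * (c ^+ 2 * e * (c ^+ 2 * sig) / eps)); last by ring.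
  rewrite (_ : (8 + 58 / eps) * D = 8 * D + 58 * (D / eps)); last by ring.
  by have := c2e_D; lra.
rewrite (misclassE hobs)//; first last.
- by rewrite -subr_gt0 m2; move: e2c; rewrite ler_norml; lra.
- by rewrite -subr_gt0 m1; move: e1c; rewrite ler_norml; lra.
rewrite (misclassE hobs)//; first last.
- by rewrite -subr_gt0 n2.
- by rewrite -subr_gt0 n1.
rewrite m1 m2 n1 n2 expr1n divr1 -/v -/vh.
have := ratio (- e1); rewrite normrN => /(_ e1c); have := ratio _ e2c.
have : 0 <= 2 / eps * D by apply: mulr_ge0 => //; exact: mulr_ge0.
(* Both rates are averages over the two groups, whose deviations are [s = - e1] and [s = e2]. *)
by rewrite !ler_norml (mulrDl _ _ D); lra.
Qed.

End road.

(** * Passage from the deterministic bound to a bound in probability *)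

Lemma probability_setI_ge (R : realType) d (T : measurableType d) (P : probability T R)
    (A B : set T) (x y : R) : measurable A -> measurable B ->
  ((1 - x)%:E <= P A)%E -> ((1 - y)%:E <= P B)%E -> ((1 - (x + y))%:E <= P (A `&` B))%E.
Proof.
move=> mA mB.
have mAB := measurableI _ _ mA mB.
have PE C : measurable C -> P C = (fine (P C))%:E by move=> mC; rewrite fineK ?fin_num_measure.
have : (P (~` (A `&` B)) <= P (~` A) + P (~` B))%E.
  rewrite setCI; exact: (measureU2 (P : {measure set T -> \bar R}) (measurableC mA) (measurableC mB)).
rewrite !probability_setC// (PE A)// (PE B)// (PE (A `&` B))// -!EFinB -EFinD !lee_fin.
by lra.
Qed.

Theorem theorem1 (R : realType) (d d' : measure_display)
  (T : nat -> measurableType d) (P : forall n, probability (T n) R)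
  (T' : nat -> measurableType d') (Q : forall n, probability (T' n) R)
  (p : nat -> nat) (mu1 mu2 : forall n, 'cV[R]_(p n))
  (Sigma : forall n, 'M[R]_(p n)) (c : nat -> R)
  (Y : forall n, T' n -> nat) (X : forall n, T' n -> 'cV[R]_(p n))
  (hSigma : forall n, is_covariance (Sigma n))
  (hobs : forall n,
     two_class_normal (Q n) (Y n) (X n) (mu1 n) (mu2 n) (Sigma n))
  (eps : R) (heps : 0 < eps)
  (hmd : forall n, eps < normInfv (halfdiff (mu1 n) (mu2 n)))
  (hc : forall n, eps + (normInfv (halfdiff (mu1 n) (mu2 n)))^-1 < c n)
  (mu1h mu2h : forall n, T n -> 'cV[R]_(p n))
  (Sigmah : forall n, T n -> 'M[R]_(p n))
  (a : nat -> R) (ha_pos : forall n, 0 < a n) (ha_lim : a @ \oo --> 0)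
  (hSigmah : bigOp P (fun n om => normInfm (Sigmah n om - Sigma n)) a)
  (hmu1h : bigOp P (fun n om => normInfv (mu1h n om - mu1 n)) a)
  (hmu2h : bigOp P (fun n om => normInfv (mu2h n om - mu2 n)) a)
  (wc : forall n, 'cV[R]_(p n))
  (hwc : forall n,
     road_argmin (c n) (halfdiff (mu1 n) (mu2 n)) (Sigma n) (wc n))
  (wh : forall n, T n -> 'cV[R]_(p n))
  (hwh : forall n om,
     (exists w, road_feasible (c n) (halfdiff (mu1h n om) (mu2h n om)) w) ->
     road_argmin (c n) (halfdiff (mu1h n om) (mu2h n om)) (Sigmah n om)
       (wh n om)) :
  bigOp P
    (fun n om =>
       misclass (Q n) (Y n) (X n)
         (lin_rule (wh n om) (halfsum (mu1h n om) (mu2h n om)))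
       - misclass (Q n) (Y n) (X n)
           (lin_rule (wc n) (halfsum (mu1 n) (mu2 n))))
    (fun n => c n ^+ 2 * a n * (1 + c n ^+ 2 * normInfm (Sigma n))).
Proof.
move=> eta eta0; have eta3 : 0 < eta / 3 by rewrite divr_gt0.
have [MS [MS0 [NS hS]]] := hSigmah _ eta3.
have [M1 [M10 [N1 h1]]] := hmu1h _ eta3.
have [M2 [M20 [N2 h2]]] := hmu2h _ eta3.
pose M := MS + M1 + M2; have M0 : 0 < M by rewrite !addr_gt0.
(* Once [a n <= delta], the error level [e = M * a n] satisfies both smallness conditions of
   [road_misclass_close]. *)
pose delta := Num.min (eps / 2) (eps ^+ 3 / 4) / M.
have delta0 : 0 < delta.
  by rewrite divr_gt0// lt_min !divr_gt0// exprn_gt0.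
have [N _ hN] := cvgr_le _ ha_lim _ delta0.
pose L := 2 * @normal_peak R 1 * (8 + 58 / eps) + 2 / eps.
have L0 : 0 < L.
  rewrite ltr_wpDl ?divr_gt0//; apply: mulr_ge0.
    by rewrite mulr_ge0 ?normal_peak_ge0.
  by rewrite addr_ge0// divr_ge0// ltW.
exists (L * M); split; first exact: mulr_gt0.
exists (maxn N (maxn NS (maxn N1 N2))) => n.
rewrite !geq_max => /and4P[/hN /= an /hS[AS [mAS [PAS eS]]]].
move=> /h1[A1 [mA1 [PA1 e1]]] /h2[A2 [mA2 [PA2 e2]]].
(* Each of the three events fails with probability at most [eta / 3], and on their intersection
   [M * a n] dominates all three estimation errors. *)
exists (AS `&` A1 `&` A2); split; first by apply: measurableI => //; exact: measurableI.
split.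
  rewrite (_ : eta = eta / 3 + eta / 3 + eta / 3); last by field.
  by apply: probability_setI_ge => //; [exact: measurableI | exact: probability_setI_ge].
move=> om [[/eS bS /e1 b1] /e2 b2].
have a0 := ltW (ha_pos n).
have le_e (x m : R) : m <= M -> `|x| <= m * a n -> x <= M * a n.
  move=> mM xm; apply: le_trans (ler_norm _) _; apply: le_trans xm _.
  by rewrite ler_wpM2r.
have := an; rewrite /delta ler_pdivlMr// mulrC le_min => /andP[Ma1 Ma2].
have := road_misclass_close (hSigma n) (hobs n) heps (hmd n) (hc n)
  (le_e _ _ _ bS) (le_e _ _ _ b1) (le_e _ _ _ b2) Ma1 Ma2 (hwc n) (hwh n om).
rewrite -/L => close; apply: le_trans (close _ _ _) _; rewrite /M; [lra|lra|lra|].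
rewrite -/M le_eqVlt; apply/orP; left; apply/eqP; ring.
Qed.
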